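(* Let $\mathcal{P}$ be a set of $n$ points in $\mathbb{R}^2$ in the existential uncertainty model with $p_v\in(0,1)$ for all $v$, and let $\tau\in(0,1/2]$, $\delta\in(0,1)$. Run the construction below with parameters $\tau_1=c_1(\tau/\lambda)^2$ and $N=c_2\tau_1^{-2}\log(1/\delta)=O\!\left(\frac{\lambda^4}{\tau^4}\log\frac{1}{\delta}\right)$ for suitable absolute constants $c_1,c_2>0$. Then with probability at least $1-\delta$ (over the sampling), for every $t\ge 0$ and every direction $u$, $$\Pr_{P\sim\mathcal{P}}[\omega(P,u)\le t]-\tau\le\Pr_{S\sim\mathcal{S}}[\omega(S,u)\le t]\le\Pr_{P\sim\mathcal{P}}[\omega(P,u)\le t]+\tau.$$
   Context: Existential model: each $v\in\mathcal{P}$ is present in a random realization independently with probability $p_v$. For a finite point set $P$, $f(P,u)=\max_{p\in P}\langle u,p\rangle$ (with $f(\emptyset,u)=0$) and $\omega(P,u)=f(P,u)+f(P,-u)$. Construction: let $\lambda_v=-\ln(1-p_v)$ and $\lambda=\sum_{v\in\mathcal{P}}\lambda_v$; let $\mathfrak{A}$ be the probability measure on $\mathcal{P}$ with $\mathfrak{A}(\{v\})=\lambda_v/\lambda$. Take $N$ independent samples from $\mathfrak{A}$ (repetitions allowed, co-located copies kept as separate points). The stochastic set $\mathcal{S}$ consists of these $N$ sample points, each present independently with existence probability $1-\exp(-\lambda/N)$.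
   Formalization: N is rounded up to an integer (so the O-bound carries a +1), and log(1/δ) is replaced by log(1/min(δ,1/2)), because with the literal formula N can be 1 as δ→1 and the claim then fails. *)

(* Defs.v *)
From HB Require Import structures.
From mathcomp Require Import all_boot all_order all_algebra.
From mathcomp Require Import all_classical all_reals all_analysis.

Set Implicit Arguments.
Unset Strict Implicit.
Unset Printing Implicit Defensive.

Import Order.TTheory GRing.Theory Num.Theory.

Local Open Scope ring_scope.

Section Geometry.
Variables (R : realType) (d : nat).
Implicit Types u v : 'rV[R]_d.

Definition dot u v : R := \sum_(k < d) u 0 k * v 0 k.

Variables (I : finType) (pt : I -> 'rV[R]_d).

(* Point sets are sets of indices of a family pt, so that co-located points
   stay separate.  The big operator starts from a member of A, which makes it
   the plain maximum over A. *)
Definition support_fun (A : {set I}) u : R :=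
  if [pick i in A] is Some i0
  then \big[Num.max/dot u (pt i0)]_(i in A) dot u (pt i)
  else 0.

Definition width (A : {set I}) u : R := support_fun A u + support_fun A (- u).

Lemma support_fun_set0 u : support_fun finset.set0 u = 0.
Proof.
by rewrite /support_fun; case: pickP => // i; rewrite inE.
Qed.

Lemma support_fun_ge (A : {set I}) u i :
  i \in A -> dot u (pt i) <= support_fun A u.
Proof.
rewrite /support_fun => iA; case: pickP => [j _|/(_ i)]; last by rewrite iA.
exact: le_bigmax_cond.
Qed.

Lemma support_fun_attained (A : {set I}) u :
  A != finset.set0 -> exists2 i, i \in A & support_fun A u = dot u (pt i).
Proof.
case/finset.set0Pn => i0 i0A; rewrite /support_fun.
case: pickP => [j jA|/(_ i0)]; last by rewrite i0A.
apply: (big_ind (fun x => exists2 i, i \in A & x = dot u (pt i))).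
- by exists j.
- move=> x y [i iA ->] [k kA ->].
  by rewrite /Num.max; case: ifP => _; [exists k | exists i].
- by move=> i iA; exists i.
Qed.

End Geometry.

Section ExistentialModel.
Variables (R : realType) (I : finType).

Definition realization_prob (q : I -> R) (A : {set I}) : R :=
  \prod_i (if i \in A then q i else 1 - q i).

Definition exist_Pr (q : I -> R) (E : pred {set I}) : R :=
  \sum_(A : {set I} | E A) realization_prob q A.

Lemma exist_PrT (q : I -> R) : exist_Pr q xpredT = 1.
Proof.
rewrite /exist_Pr /realization_prob.
have := bigA_distr 1 +%R q (fun i => 1 - q i).
rewrite /= => <-.
by rewrite big1 // => i _; rewrite addrC subrK.
Qed.

End ExistentialModel.

Section Construction.
Variables (R : realType) (n : nat) (p : 'I_n -> R).

Definition rate (v : 'I_n) : R := - ln (1 - p v).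

Definition total_rate : R := \sum_v rate v.

Definition rate_measure (v : 'I_n) : R := rate v / total_rate.

(* Probability that N independent samples from the mass function mu, recorded
   as x : {ffun 'I_N -> 'I_n}, satisfy E. *)
Definition sampling_Pr (mu : 'I_n -> R) (N : nat)
    (E : {ffun 'I_N -> 'I_n} -> Prop) : R :=
  \sum_(x : {ffun 'I_N -> 'I_n} | `[< E x >]) \prod_(i < N) mu (x i).

Lemma sampling_PrT (N : nat) :
  total_rate != 0 -> sampling_Pr rate_measure (fun=> True) (N := N) = 1.
Proof.
move=> lam0; rewrite /sampling_Pr.
under eq_bigl do rewrite asboolT //.
rewrite -(bigA_distr_bigA (fun (_ : 'I_N) v => rate_measure v)) big1 // => i _.
by rewrite /rate_measure -mulr_suml divff.
Qed.

End Construction.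

(* log (1 / delta), with delta capped at 1/2: for delta <= 1/2 this is exactly
   ln (1 / delta).  Since ln (1 / delta) tends to 0 as delta tends to 1, without
   a cap a bound of the form c * ln (1 / delta) would allow a single sample,
   for which the approximation fails. *)
Definition log_inv (R : realType) (delta : R) : R :=
  ln (1 / Num.min delta (1 / 2)).

Definition sample_count (R : realType) (c2 tau1 delta : R) : nat :=
  `|Num.ceil (c2 * tau1 ^- 2 * log_inv delta)|%N.

(* Main.v *)
(* A present point set avoids W with probability exp(-w(W)), where w gives weight
   lambda_v to the point v of P and lambda/N to each sample.  Conditioning on the
   lowest present point in direction u therefore writes Pr[width <= t] as a
   Stieltjes sum of two monotone functions, each of the form exp(-w(halfplane)),
   and summation by parts shows that it moves by at most 2 eta when the weights
   of all halfplanes move by at most eta.  So it suffices that the empirical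
   measure of the samples is within eps = tau/(2 lambda) of the rate measure on
   all halfplanes.  This is weaker than accuracy tau1 ~ (tau/lambda)^2, and the
   slack in N absorbs the logarithm in the Vapnik-Chervonenkis bound
   2 (2N+1)^3 exp(-N eps^2/8).  If lambda <= tau, both point sets are empty with
   probability at least 1 - tau and nothing has to be sampled accurately. *)
Require Import Defs.
From HB Require Import structures.
From mathcomp Require Import all_boot all_order all_algebra.
From mathcomp Require Import all_classical all_reals all_analysis.
From mathcomp Require Import ring lra zify.

Set Implicit Arguments.
Unset Strict Implicit.
Unset Printing Implicit Defensive.

Import Order.TTheory GRing.Theory Num.Theory.

Local Open Scope ring_scope.

(** * Shattering by halfspaces *)

Definition traces (T : finType) (F : {set {set T}}) (X : {set T}) :
  {set {set T}} := [set H :&: X | H in F]%SET.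

Definition shatters (T : finType) (F : {set {set T}}) (Y : {set T}) : bool :=
  powerset Y \subset traces F Y.

Lemma shattersP (T : finType) (F : {set {set T}}) (Y : {set T}) :
  reflect (forall Z : {set T}, Z \subset Y ->
             exists2 H, H \in F & H :&: Y = Z)%SET
          (shatters F Y).
Proof.
apply: (iffP fintype.subsetP) => sh Z.
  rewrite -powersetE => /sh /imsetP[H HF ->]; by exists H.
rewrite powersetE => /sh[H HF <-]; exact: imset_f.
Qed.

Lemma shatters_sub {T : finType} {F G : {set {set T}}} {Y : {set T}} :
  F \subset G -> shatters F Y -> shatters G Y.
Proof.
move=> FG /shattersP sh; apply/shattersP => Z /sh[H HF <-].
by exists H => //; apply: (fintype.subsetP FG).
Qed.

(* Pajor's form of the Sauer-Shelah lemma: split F on an element a that lies in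
   some but not all of its members; a set shattered by both halves stays
   shattered by F once a is added. *)
Lemma card_le_shattered (T : finType) (F : {set {set T}}) :
  (#|F| <= #|[set Y | shatters F Y]%SET|)%N.
Proof.
have [k] := ubnP #|F|; elim: k F => // k IH F Fk.
have [F1|] := leqP #|F| 1.
  case: (finset.set_0Vmem F) => [->|[H HF]]; first by rewrite cards0.
  apply: leq_trans F1 _; rewrite card_gt0; apply/finset.set0Pn.
  exists finset.set0; rewrite inE; apply/shattersP => Z.
  by rewrite finset.subset0 => /eqP->; exists H => //; rewrite finset.setI0.
case/card_gt1P => H1 [H2] [H1F H2F H12].
have [a aH] : exists a, (a \in H1) != (a \in H2).
  apply/existsP; apply: contraR H12 => /existsPn h.
  by apply/eqP/setP => b; apply/eqP; rewrite -[_ == _]negbK h.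
set FI := [set H in F | a \in H]%SET; set FO := [set H in F | a \notin H]%SET.
have cF : #|F| = (#|FI| + #|FO|)%N.
  rewrite -(cardsID [set H : {set T} | a \in H]%SET F); congr (_ + _)%N;
    by apply: eq_card => H; rewrite !inE // andbC.
have FI0 : (0 < #|FI|)%N.
  rewrite card_gt0; apply/finset.set0Pn.
  by move: aH; case: (boolP (a \in H1)) => h1 h2; [exists H1|exists H2];
     rewrite inE ?H1F ?H2F //; case: (a \in H2) h2.
have FO0 : (0 < #|FO|)%N.
  rewrite card_gt0; apply/finset.set0Pn.
  by move: aH; case: (boolP (a \in H1)) => h1 h2; [exists H2|exists H1];
     rewrite inE ?H1F ?H2F //; case: (a \in H2) h2.
have sI : FI \subset F by apply/fintype.subsetP => H; rewrite inE => /andP[].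
have sO : FO \subset F by apply/fintype.subsetP => H; rewrite inE => /andP[].
set SI := [set Y | shatters FI Y]%SET; set SO := [set Y | shatters FO Y]%SET.
have IHI : (#|FI| <= #|SI|)%N by apply: IH; lia.
have IHO : (#|FO| <= #|SO|)%N by apply: IH; lia.
have aI Y : Y \in SI -> a \notin Y.
  rewrite inE => /shattersP/(_ finset.set0 (finset.sub0set _))[H].
  rewrite inE => /andP[_ aH'] HY0; apply/negP => aY.
  by move/setP: HY0 => /(_ a); rewrite !inE aH' aY.
have aO Y : Y \in SO -> a \notin Y.
  rewrite inE => /shattersP/(_ Y (fintype.subxx _))[H].
  rewrite inE => /andP[_ aH'] HY; apply/negP => aY.
  by move/setP: HY => /(_ a); rewrite !inE (negbTE aH') aY.
(* [#|SI| + #|SO|] counts [SI :&: SO] twice. Adding [a] turns the second copy into new sets, because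
   no member of [SI] or [SO] contains [a]. *)
set SA := [set (a |: Y) | Y in SI :&: SO]%SET.
have cA : #|SA| = #|(SI :&: SO)%SET|.
  apply: card_in_imset => Y Z /setIP[/aI aY _] /setIP[/aI aZ _] /setP YZ.
  apply/setP => b; move: (YZ b); rewrite !inE.
  by have [->|] := eqVneq b a => //; rewrite (negbTE aY) (negbTE aZ).
have dA : [disjoint (SI :|: SO)%SET & SA].
  rewrite -setI_eq0; apply/eqP/setP => Y; rewrite [RHS]inE.
  apply/negbTE/negP => /setIP[YU /imsetP[Z _ YZ]].
  have : a \notin Y by case/setUP: YU; [apply: aI|apply: aO].
  by rewrite YZ !inE eqxx.
rewrite cF; apply: (leq_trans (leq_add IHI IHO)).
rewrite -cardsUI -cA.
have /leqif_refl := dA; move: (leq_card_setU (SI :|: SO)%SET SA) => [_].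
rewrite dA => /eqP <- _; apply: subset_leq_card; apply/fintype.subsetP => Y.
case/setUP => [/setUP[]|/imsetP[Z /setIP[]]]; rewrite !inE.
- exact: shatters_sub.
- exact: shatters_sub.
move=> shI shO ->; have aZ : a \notin Z by apply: aI; rewrite inE.
apply/shattersP => W WZ.
have WZ' : W :\ a \subset Z by rewrite subDset.
(* The trace on [Z] comes from the half of [F] whose members agree with [W] at [a]. *)
have [aW|aW] := boolP (a \in W).
  have [H HF HW] := shattersP _ _ shI _ WZ'; move: HF; rewrite inE => /andP[HF aH'].
  exists H => //; apply/setP => b; move/setP: HW => /(_ b); rewrite !inE.
  by have [->|] := eqVneq b a => //=; rewrite aW aH'.
have [H HF HW] := shattersP _ _ shO _ WZ'; move: HF; rewrite inE => /andP[HF aH'].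
exists H => //; apply/setP => b; move/setP: HW => /(_ b); rewrite !inE.
by have [->|] := eqVneq b a => //=; rewrite (negbTE aW) (negbTE aH').
Qed.

Lemma card_draws_le (T : finType) (X : {set T}) k :
  (#|[set Y : {set T} | Y \subset X & #|Y| == k]%SET| <= #|X| ^ k)%N.
Proof.
rewrite cards_draws; apply: leq_trans (leq_pmulr _ (fact_gt0 k)) _.
rewrite bin_ffact; elim: k => // k IH.
by rewrite ffactnSr expnSr leq_mul // leq_subr.
Qed.

(** Sauer-Shelah growth: a set shattered by the traces lies in [X] and is shattered by [F], so with
    m = [#|X|] there are at most 1 + m + m^2 + m^3 of them. *)
Lemma card_traces_le (T : finType) (F : {set {set T}}) (X : {set T}) :
  (forall Y : {set T}, shatters F Y -> (#|Y| <= 3)%N) ->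
  (#|traces F X| <= #|X|.+1 ^ 3)%N.
Proof.
move=> shF; apply: leq_trans (card_le_shattered _) _.
pose D k := [set Y : {set T} | Y \subset X & #|Y| == k]%SET.
have : [set Y | shatters (traces F X) Y]%SET \subset
       (D 0 :|: D 1 :|: D 2 :|: D 3)%SET.
  apply/fintype.subsetP => Y; rewrite inE => /shattersP sh.
  have YX : Y \subset X.
    have [H /imsetP[H' _ ->] /finset.setIidPr YH] := sh Y (fintype.subxx _).
    exact: fintype.subset_trans YH (subsetIr _ _).
  have /shF : shatters F Y.
    apply/shattersP => Z /sh[H /imsetP[H' HF ->] <-]; exists H' => //.
    by rewrite -finset.setIA (finset.setIidPr YX).
  by rewrite !inE YX; case: #|Y| => [|[|[|[|]]]].
move/subset_leq_card => h; apply: leq_trans h _.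
apply: (@leq_trans (#|D 0| + #|D 1| + #|D 2| + #|D 3|)%N).
  apply: leq_trans (leq_card_setU _ _) _; rewrite leq_add2r.
  apply: leq_trans (leq_card_setU _ _) _; rewrite leq_add2r.
  exact: leq_card_setU.
have c0 := card_draws_le X 0; have c1 := card_draws_le X 1.
have c2 := card_draws_le X 2; have c3 := card_draws_le X 3.
apply: leq_trans (leq_add (leq_add (leq_add c0 c1) c2) c3) _.
by set m := #|X|; rewrite !expnS expn0; nia.
Qed.

Definition halfspaces (R : realType) (T : finType) (d : nat)
    (pt : T -> 'rV[R]_d) : {set {set T}} :=
  [set H : {set T} |
    `[< exists u s, H = [set v | dot u (pt v) <= s]%SET >]]%SET.

Lemma mem_halfspaces (R : realType) (T : finType) (d : nat)
    (pt : T -> 'rV[R]_d) (u : 'rV[R]_d) (s : R) :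
  [set v | dot u (pt v) <= s]%SET \in halfspaces pt.
Proof. by rewrite inE; apply/asboolP; exists u, s. Qed.

(* Radon: an affine dependency a of the points of Y, split by the sign of its
   coefficients, cannot be separated by a hyperplane. *)
Lemma card_shattered_halfspaces (R : realType) (T : finType) (d : nat)
    (pt : T -> 'rV[R]_d) (Y : {set T}) :
  shatters (halfspaces pt) Y -> (#|Y| <= d.+1)%N.
Proof.
move=> /shattersP sh; rewrite leqNgt; apply/negP => cY.
(* The column of ones makes a left kernel vector an affine dependency; it exists because [A] has
   more than d + 1 rows. *)
pose A : 'M[R]_(#|Y|, d + 1) :=
  row_mx (\matrix_(i, k) pt (enum_val i) 0 k) (const_mx 1).
have /rowV0Pn[a /sub_kermxP] : kermx A != 0.
  by rewrite kermx_eq0 -row_leq_rank -ltnNge (leq_ltn_trans (rank_leq_col _)) // addn1.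
rewrite mul_mx_row -row_mx0 => /eq_row_mx[aA a1] a0.
have suma : \sum_i a 0 i = 0.
  have /rowP/(_ 0) := a1; rewrite !mxE => h; rewrite -[RHS]h.
  by apply: eq_bigr => i _; rewrite mxE mulr1.
have dota u : \sum_i a 0 i * dot u (pt (enum_val i)) = 0.
  rewrite /dot; under eq_bigr do rewrite mulr_sumr.
  rewrite exchange_big big1 //= => k _.
  have /rowP/(_ k) := aA; rewrite !mxE => h; rewrite -[RHS](mulr0 (u 0 k)) -[in RHS]h.
  by rewrite mulr_sumr; apply: eq_bigr => i _; rewrite mxE mulrCA.
pose Z := [set v in Y | [exists i, (enum_val i == v) && (0 < a 0 i)]]%SET.
have [H] : exists2 H, H \in halfspaces pt & (H :&: Y)%SET = Z.
  by apply: sh; apply/fintype.subsetP => v; rewrite inE => /andP[].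
rewrite inE => /asboolP[u [s ->]] /setP HZ.
have side i : (dot u (pt (enum_val i)) <= s) = (0 < a 0 i).
  move: (HZ (enum_val i)); rewrite !inE (enum_valP i) andbT /= => ->.
  apply/existsP/idP => [[j /andP[/eqP/enum_val_inj -> //]]|ai].
  by exists i; rewrite eqxx.
have term i : 0 <= a 0 i * (s - dot u (pt (enum_val i))).
  have := side i; case: ltP => ai; first by move=> ?; rewrite mulr_ge0 ?subr_ge0 // ltW.
  by move/negbT; rewrite -ltNge => si; rewrite mulr_le0 // subr_le0 ltW.
have sum0 : \sum_i a 0 i * (s - dot u (pt (enum_val i))) = 0.
  under eq_bigr do rewrite mulrBr.
  by rewrite sumrB dota subr0 -mulr_suml suma mul0r.
(* The nonnegative terms sum to 0, so each vanishes. Hence [a 0 i] is 0 or the point lies on the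
   boundary, where [side] makes [a 0 i] positive. Nonnegative coefficients with sum 0 are all 0. *)
have anneg i : 0 <= a 0 i.
  have /eqP := sum0; rewrite psumr_eq0 // => /allP/(_ i (mem_index_enum _)).
  rewrite /= mulf_eq0 => /orP[/eqP->//|].
  by rewrite subr_eq0 => /eqP si; have := side i; rewrite -si lexx => /esym/ltW.
case/negP: a0; apply/eqP/rowP => i; rewrite mxE.
have /eqP := suma; rewrite psumr_eq0 // => /allP/(_ i (mem_index_enum _)).
by move=> /= /eqP.
Qed.

(** * Uniform convergence of the empirical measure *)

(** Moment bound for a random sign. The inequality 1 + x <= exp x bounds the sum by 2 / (1 - x^2),
    and 1 / (1 - y) <= 1 + 2 y for 0 <= y <= 1/4. *)
Lemma cosh_le_expR (R : realType) (x : R) :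
  `|x| <= 1 / 2 -> expR x + expR (- x) <= 2 * expR (2 * x ^+ 2).
Proof.
rewrite ler_norml => /andP[x1 x2].
have y1 : expR x <= (1 - x)^-1.
  have := expR_ge1Dx (- x); have := expR_gt0 x; rewrite expRN => e0 h.
  by rewrite -[expR x]invrK lef_pV2 ?posrE ?invr_gt0 //; lra.
have y2 : expR (- x) <= (1 + x)^-1.
  by rewrite expRN lef_pV2 ?posrE ?expR_gt0 ?expR_ge1Dx //; lra.
have y3 : (1 - x)^-1 + (1 + x)^-1 <= 2 * (1 + 2 * x ^+ 2).
  have -> : (1 - x)^-1 + (1 + x)^-1 = 2 / (1 - x ^+ 2).
    by field; apply/and3P; split; apply/eqP; nra.
  have : 0 <= x ^+ 2 <= 1 / 4 by rewrite sqr_ge0 /=; nra.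
  by move: (x ^+ 2) => y /andP[? ?]; rewrite ler_pdivrMr; nra.
have := expR_ge1Dx (2 * x ^+ 2); lra.
Qed.

(** Jensen's inequality: bound exp from below by its tangent at the mean, whose linear term averages
    to 0. *)
Lemma expR_mean_le (R : realType) (T : finType) (mu f : T -> R) (c : R) :
  (forall v, 0 <= mu v) -> \sum_v mu v = 1 ->
  expR (c - \sum_v mu v * f v) <= \sum_v mu v * expR (c - f v).
Proof.
move=> mu0 mu1; set m := \sum_v mu v * f v.
have -> : expR (c - m) = \sum_v mu v * (expR (c - m) * (1 + (m - f v))).
  under eq_bigr do rewrite mulrCA mulrDr mulr1 mulrBr.
  rewrite -mulr_sumr big_split sumrB /= -mulr_suml mu1 mul1r -/m subrr addr0.
  by rewrite mulr1.
apply: ler_sum => v _; apply: ler_wpM2l => //.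
have -> : c - f v = (c - m) + (m - f v) by ring.
by rewrite [leRHS]expRD ler_wpM2l ?expR_ge0 // expR_ge1Dx.
Qed.

Section UniformConvergence.
Variables (R : realType) (T : finType) (mu : T -> R) (N : nat).
Hypotheses (mu_ge0 : forall v, 0 <= mu v) (mu_sum1 : \sum_v mu v = 1).

Let sample := {ffun 'I_N -> T}.
Implicit Types (x y : sample) (A H : {set T}).

Definition hits x A : nat := #|[set i | x i \in A]%SET|.

Definition samples_prob x : R := \prod_i mu (x i).

Definition deviates (F : {set {set T}}) (eps : R) x : bool :=
  [exists H in F, eps * N%:R < `|(hits x H)%:R - N%:R * \sum_(v in H) mu v|].

Let point_set x y : {set T} := [set v | [exists i, (x i == v) || (y i == v)]]%SET.

Let sgn (b : bool) (r : R) : R := if b then - r else r.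

(** This is exp (theta * (hits x A - hits y A)), with the difference negated when [b] holds so that
    both tails are covered. The product form lets averages factor over the coordinates. *)
Let gap (theta : R) A b x y : R :=
  \prod_i expR (theta * sgn b ((x i \in A)%:R - (y i \in A)%:R)).

(** The bits of [s] act as Rademacher signs: swapping [x i] with the ghost [y i] preserves the
    product law and negates the i-th difference of indicators. *)
Let swap (s : {ffun 'I_N -> bool}) (xy : sample * sample) : sample * sample :=
  ([ffun i => if s i then xy.2 i else xy.1 i],
   [ffun i => if s i then xy.1 i else xy.2 i]).

Let swapK s : involutive (swap s).
Proof.
by case=> x y; congr pair; apply/ffunP => i; rewrite !ffunE /=; case: (s i).
Qed.

Let point_set_swap s xy :
  point_set (swap s xy).1 (swap s xy).2 = point_set xy.1 xy.2.
Proof.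
apply/setP => v; rewrite !inE; apply: eq_existsb => i; rewrite !ffunE.
by case: (s i); rewrite // orbC.
Qed.

Let samples_prob_swap s xy :
  samples_prob (swap s xy).1 * samples_prob (swap s xy).2 =
  samples_prob xy.1 * samples_prob xy.2.
Proof.
rewrite /samples_prob -!big_split /=; apply: eq_bigr => i _; rewrite !ffunE.
by case: (s i) => //; rewrite mulrC.
Qed.

Let card_point_set x y : (#|point_set x y| <= N.*2)%N.
Proof.
have -> : point_set x y = ([set x i | i in 'I_N] :|: [set y i | i in 'I_N])%SET.
  apply/setP => v; rewrite !inE; apply/existsP/orP.
    by case=> i /orP[/eqP<-|/eqP<-]; [left|right]; apply: imset_f.
  by case=> /imsetP[i _ ->]; exists i; rewrite eqxx ?orbT.
apply: leq_trans (leq_card_setU _ _) _; rewrite -addnn.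
by apply: leq_add; apply: leq_trans (leq_imset_card _ _) _; rewrite card_ord.
Qed.

Lemma samples_prob_ge0 x : 0 <= samples_prob x.
Proof. exact: prodr_ge0. Qed.

Lemma samples_prob_sum : \sum_x samples_prob x = 1.
Proof.
by rewrite -(bigA_distr_bigA (fun _ v => mu v)) big1.
Qed.

Let gap_ge0 theta A b x y : 0 <= gap theta A b x y.
Proof. by apply: prodr_ge0 => i _; apply: expR_ge0. Qed.

(** Only the trace on the 2N points matters, so a supremum over [F] can be replaced by a sum over
    finitely many traces. *)
Let gap_point_set theta A b x y :
  gap theta (A :&: point_set x y)%SET b x y = gap theta A b x y.
Proof.
apply: eq_bigr => i _.
have xi : x i \in point_set x y by rewrite inE; apply/existsP; exists i; rewrite eqxx.
have yi : y i \in point_set x y.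
  by rewrite inE; apply/existsP; exists i; rewrite eqxx orbT.
by rewrite !finset.in_setI xi yi !andbT.
Qed.

Let gap_sum_swap (theta : R) A b xy : 0 <= theta <= 1 / 2 ->
  \sum_s gap theta A b (swap s xy).1 (swap s xy).2 <=
  2 ^+ N * expR (2 * theta ^+ 2) ^+ N.
Proof.
case/andP=> th0 th1; case: xy => x y; rewrite /gap /=.
(* A swap at [i] toggles the sign [b], so the sum over [s] becomes a product of sums of two
   exponentials, each bounded by [cosh_le_expR]. *)
pose g i (c : bool) := expR (theta * sgn (b (+) c) ((x i \in A)%:R - (y i \in A)%:R)).
have -> : \sum_(s : {ffun 'I_N -> bool}) \prod_i expR (theta * sgn b
    (([ffun i => if s i then y i else x i] i \in A)%:R -
     ([ffun i => if s i then x i else y i] i \in A)%:R)) =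
    \sum_(s : {ffun 'I_N -> bool}) \prod_i g i (s i).
  apply: eq_bigr => s _; apply: eq_bigr => i _; rewrite /g !ffunE; congr expR.
  by case: (s i); case: (b); rewrite /sgn /= ?opprB.
rewrite -bigA_distr_bigA -exprMn -[N in leRHS]card_ord -prodr_const.
apply: ler_prod => i _; apply/andP; split.
  by apply: sumr_ge0 => c _; apply: expR_ge0.
rewrite big_bool /g; set r := _%:R - _%:R.
rewrite [leLHS](_ : _ = expR (theta * r) + expR (- (theta * r))); last first.
  by case: (b); rewrite /sgn /= mulrN // addrC.
have r1 : `|r| <= 1 by rewrite /r; case: (_ \in A); case: (_ \in A); rewrite ?subr0 ?sub0r ?subrr ?normrN ?normr1 ?normr0.
apply: le_trans (cosh_le_expR _) _.
  rewrite normrM ger0_norm //; have := normr_ge0 r; nra.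
rewrite ler_pM2l // ler_expR ler_pM2l // exprMn ler_piMr ?sqr_ge0 //.
by rewrite -real_normK ?num_real // expr_le1.
Qed.

(** N mu(A) is the mean number of hits of the ghost sample, and Jensen's inequality is applied in
    each coordinate. *)
Let expR_deviation theta A b x :
  expR (theta * sgn b ((hits x A)%:R - N%:R * \sum_(v in A) mu v)) <=
  \sum_y samples_prob y * gap theta A b x y.
Proof.
rewrite /samples_prob /gap; under [leRHS]eq_bigr do rewrite -big_split /=.
rewrite -(bigA_distr_bigA (fun i v =>
  mu v * expR (theta * sgn b ((x i \in A)%:R - (v \in A)%:R)))).
have -> : theta * sgn b ((hits x A)%:R - N%:R * \sum_(v in A) mu v) =
    \sum_i (theta * sgn b (x i \in A)%:R -
            \sum_v mu v * (theta * sgn b (v \in A)%:R)).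
  rewrite sumrB sumr_const card_ord.
  have -> : \sum_v mu v * (theta * sgn b (v \in A)%:R) =
            theta * sgn b (\sum_(v in A) mu v).
    rewrite (big_mkcond (fun v => v \in A)) /=.
    transitivity (\sum_v theta * sgn b (if v \in A then mu v else 0)).
      by apply: eq_bigr => v _; case: (v \in A); case: b; rewrite /sgn /= ?mulr1n ?mulr0n; ring.
    by rewrite -mulr_sumr; case: b; rewrite /sgn ?sumrN.
  rewrite -mulr_sumr /hits cardsE -sum1_card natr_sum (big_mkcond (fun i => x i \in A)).
  have -> : \sum_i sgn b (x i \in A)%:R = sgn b (\sum_i (if x i \in A then 1 else 0)).
    by case: b; rewrite /sgn ?sumrN; [congr (- _)|]; apply: eq_bigr => i _; case: (_ \in _).
  by case: b; rewrite /sgn; ring.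
rewrite expR_sum; apply: ler_prod => i _; rewrite expR_ge0 /=.
apply: le_trans (expR_mean_le _ _ mu_ge0 mu_sum1) _.
apply: ler_sum => v _; rewrite (_ : _ - _ = theta * sgn b ((x i \in A)%:R - (v \in A)%:R)) //.
by case: b; rewrite /sgn; ring.
Qed.

(* The Vapnik-Chervonenkis argument in exponential form: Jensen introduces an
   independent ghost sample y, and averaging over the coordinatewise swaps of x
   and y leaves one Rademacher sum for each trace on their 2N points. *)
Lemma sampling_deviation_le (F : {set {set T}}) (eps : R) (G : nat) :
  0 < eps <= 1 / 2 ->
  (forall X : {set T}, (#|X| <= N.*2)%N -> (#|traces F X| <= G)%N) ->
  \sum_(x | deviates F eps x) samples_prob x <=
  2 * G%:R * expR (- (N%:R * eps ^+ 2 / 8)).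
Proof.
(* This [theta] minimizes 2 theta^2 - theta eps; the minimum is - eps^2 / 8. *)
move=> /andP[e0 e1] trG; pose theta := eps / 4.
pose Phi (xy : sample * sample) : R := \sum_(A in traces F (point_set xy.1 xy.2))
  \sum_(b : bool) gap theta A b xy.1 xy.2.
have Phi_ge x y H b : H \in F -> gap theta H b x y <= Phi (x, y).
  move=> HF; rewrite /Phi /= (bigD1 (H :&: point_set x y)%SET) /=; last exact: imset_f.
  rewrite big_bool !gap_point_set.
  apply: ler_wpDr; first by apply: sumr_ge0 => A _; apply: sumr_ge0.
  by case: b; rewrite ?lerDl ?lerDr gap_ge0.
have step1 : expR (theta * (eps * N%:R)) * (\sum_(x | deviates F eps x) samples_prob x)
    <= \sum_xy samples_prob xy.1 * samples_prob xy.2 * Phi xy.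
  rewrite -(pair_bigA _ (fun x y => samples_prob x * samples_prob y * Phi (x, y))) /=.
  rewrite mulr_sumr big_mkcond /=; apply: ler_sum => x _.
  under [leRHS]eq_bigr do rewrite -mulrA.
  rewrite -mulr_sumr; case: ifP => [/existsP[H /andP[HF dev]]|_]; last first.
    rewrite mulr_ge0 ?samples_prob_ge0 //; apply: sumr_ge0 => y _.
    rewrite mulr_ge0 ?samples_prob_ge0 //.
    by apply: sumr_ge0 => A _; apply: sumr_ge0.
  rewrite mulrC ler_wpM2l ?samples_prob_ge0 //.
  set D := (hits x H)%:R - _ in dev; pose b := D < 0.
  apply: (@le_trans _ _ (\sum_y samples_prob y * gap theta H b x y)).
    apply: le_trans (expR_deviation _ _ _ _); rewrite ler_expR ler_wpM2l //.
      by rewrite /theta; lra.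
    rewrite -/D /b /sgn; apply/ltW; move: dev.
    by case: (ltP D 0) => D0; [rewrite ltr0_norm|rewrite ger0_norm].
  by apply: ler_sum => y _; rewrite ler_wpM2l ?samples_prob_ge0 ?Phi_ge.
(* The factor 2^N is the number of swaps: each swap leaves the sum unchanged, so 2^N copies become a
   sum over all [s]. *)
have step2 : 2 ^+ N * \sum_xy samples_prob xy.1 * samples_prob xy.2 * Phi xy <=
    2 ^+ N * (2 * G%:R * expR (2 * theta ^+ 2) ^+ N).
  have -> : 2 ^+ N * \sum_xy samples_prob xy.1 * samples_prob xy.2 * Phi xy =
    \sum_(s : {ffun 'I_N -> bool}) \sum_xy
       samples_prob xy.1 * samples_prob xy.2 * Phi (swap s xy).
    rewrite [RHS](eq_bigr (fun=> \sum_xy samples_prob xy.1 * samples_prob xy.2 * Phi xy)).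
      by rewrite sumr_const card_ffun card_bool card_ord -[RHS]mulr_natl natrX.
    move=> s _; rewrite [RHS](reindex_inj (inv_inj (swapK s))).
    by apply: eq_bigr => xy _; rewrite samples_prob_swap.
  rewrite exchange_big /=.
  apply: (@le_trans _ _ (\sum_(xy : sample * sample) samples_prob xy.1 * samples_prob xy.2 *
      (2 ^+ N * (2 * G%:R * expR (2 * theta ^+ 2) ^+ N)))); last first.
    rewrite -mulr_suml -(pair_bigA _ (fun x y => samples_prob x * samples_prob y)) /=.
    under eq_bigr do rewrite -mulr_sumr samples_prob_sum mulr1.
    by rewrite samples_prob_sum mul1r.
  apply: ler_sum => xy _; rewrite -mulr_sumr ler_wpM2l ?mulr_ge0 ?samples_prob_ge0 //.
  (* The 2N points are invariant under swaps, so the traces do not depend on [s] and the sum over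
     [s] can move inside. *)
  rewrite /Phi; under eq_bigr do rewrite point_set_swap.
  rewrite exchange_big /=; under eq_bigr do rewrite exchange_big /=.
  apply: (@le_trans _ _ (\sum_(A in traces F (point_set xy.1 xy.2)) \sum_(b : bool)
     2 ^+ N * expR (2 * theta ^+ 2) ^+ N)).
    apply: ler_sum => A _; apply: ler_sum => b _; apply: gap_sum_swap.
    by rewrite /theta; apply/andP; split; lra.
  rewrite sumr_const sumr_const card_bool -mulrnA -[leLHS]mulr_natr natrM.
  have trc : (#|traces F (point_set xy.1 xy.2)|%:R : R) <= G%:R.
    by rewrite ler_nat trG // card_point_set.
  rewrite [leRHS](_ : _ = 2 ^+ N * expR (2 * theta ^+ 2) ^+ N * (2 * G%:R)); last by ring.
  by rewrite ler_wpM2l ?ler_wpM2l ?mulr_ge0 ?exprn_ge0 ?expR_ge0.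
move: step2; rewrite ler_pM2l ?exprn_gt0 // => /(le_trans step1).
rewrite mulrC -ler_pdivlMr ?expR_gt0 // => /le_trans; apply.
rewrite -[leLHS]mulrA ler_wpM2l ?mulr_ge0 // -expRM_natl -expRN -expRD ler_expR.
by rewrite /theta le_eqVlt; apply/orP; left; apply/eqP; field.
Qed.

End UniformConvergence.

(** * Stability of the width distribution *)

Lemma expRN_lip (R : realType) (x y : R) : 0 <= x -> 0 <= y ->
  `|expR (- x) - expR (- y)| <= `|x - y|.
Proof.
wlog xy : x y / x <= y => [hw x0 y0|x0 y0].
  have [xy|/ltW xy] := leP x y; first exact: hw.
  by rewrite distrC [leRHS]distrC hw.
rewrite distrC [leRHS]distrC (ler0_norm (x := expR _ - _)); last first.
  by rewrite subr_le0 ler_expR lerN2.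
rewrite ger0_norm ?subr_ge0 // opprB.
have -> : - y = - x + (x - y) by ring.
have e1 : expR (- x) <= 1 by rewrite -expR0 ler_expR oppr_le0.
by rewrite expRD; have := expR_ge1Dx (x - y); have := expR_gt0 (- x); nra.
Qed.

Definition avoids (I : finType) (P : pred I) (A : {set I}) : bool :=
  [forall i in A, ~~ P i].

Section PoissonWeights.
Variables (R : realType) (I : finType) (q w : I -> R).
Hypothesis qw : forall i, 1 - q i = expR (- w i).

Lemma exist_PrE (E : pred {set I}) :
  exist_Pr q E = \sum_A realization_prob q A * (E A)%:R.
Proof.
rewrite /exist_Pr big_mkcond; apply: eq_bigr => A _.
by case: (E A); rewrite ?mulr1 ?mulr0.
Qed.

Lemma exist_Pr_avoids (P : pred I) :
  exist_Pr q (avoids P) = expR (- \sum_(i | P i) w i).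
Proof.
(* Replacing [q] by 0 on [P] kills exactly the sets that meet [P]; the sum over all sets then
   factors over the points. *)
transitivity (\sum_(A : {set I}) \prod_i
    (if i \in A then (if P i then 0 else q i) else 1 - q i)).
  rewrite /exist_Pr big_mkcond; apply: eq_bigr => A _.
  rewrite /avoids; case: ifP => [/forallP h|/negbT].
    apply: eq_bigr => i _; have := h i.
    by case: (i \in A) => //= /negbTE ->.
  rewrite negb_forall => /existsP[i]; rewrite negb_imply negbK => /andP[iA Pi].
  by rewrite (bigD1 i) //= iA Pi mul0r.
have := bigA_distr 1 +%R (fun i => if P i then 0 else q i) (fun i => 1 - q i).
rewrite /= => <-; rewrite -sumrN expR_sum [RHS]big_mkcond; apply: eq_bigr => i _ /=.
by rewrite -qw; case: (P i); [rewrite add0r|rewrite addrC subrK].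
Qed.

Hypothesis w_ge0 : forall i, 0 <= w i.

Lemma exist_Pr_mono (E E' : pred {set I}) :
  (forall A, E A -> E' A) -> exist_Pr q E <= exist_Pr q E'.
Proof.
move=> EE'; rewrite !exist_PrE; apply: ler_sum => A _.
rewrite ler_wpM2l //; last by have := EE' A; case: (E A); case: (E' A) => // ->.
apply: prodr_ge0 => i _; case: ifP => _; last by rewrite qw expR_ge0.
have : expR (- w i) <= 1 by rewrite -expR0 ler_expR oppr_le0.
by have := qw i; lra.
Qed.

Lemma exist_Pr_le1 (E : pred {set I}) : exist_Pr q E <= 1.
Proof. by rewrite -(exist_PrT q); apply: exist_Pr_mono. Qed.

End PoissonWeights.

Lemma width_set0 (R : realType) (d : nat) (I : finType) (pt : I -> 'rV[R]_d) u :
  width pt finset.set0 u = 0.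
Proof. by rewrite /width !support_fun_set0 addr0. Qed.

Lemma dotN (R : realType) (d : nat) (u v : 'rV[R]_d) : dot (- u) v = - dot u v.
Proof.
by rewrite /dot -sumrN; apply: eq_bigr => k _; rewrite mxE mulNr.
Qed.

(** The width is the maximum minus the minimum of [dot u]. Once the lowest point is fixed, the width
    condition says that an open halfplane is empty. *)
Lemma width_leE (R : realType) (d : nat) (I : finType) (pt : I -> 'rV[R]_d)
    (A : {set I}) (u : 'rV[R]_d) (t : R) : A != finset.set0 ->
  exists j, [/\ j \in A, forall i, i \in A -> dot u (pt j) <= dot u (pt i) &
    (width pt A u <= t) = avoids (fun i => dot u (pt j) + t < dot u (pt i)) A].
Proof.
move=> A0; have [j jA sj] := support_fun_attained pt (- u) A0.
have [k kA sk] := support_fun_attained pt u A0.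
exists j; split=> // [i iA|].
  by have := support_fun_ge pt (- u) iA; rewrite sj !dotN; lra.
rewrite /width sj dotN; apply/idP/forallP => [h i|/(_ k)].
  by apply/implyP => iA; rewrite -leNgt; have := support_fun_ge pt u iA; lra.
by rewrite kA /= -leNgt sk; lra.
Qed.

(* Split according to the rank k of the lowest present point in direction u. *)
Lemma exist_Pr_width (R : realType) (d : nat) (I : finType)
    (pt : I -> 'rV[R]_d) (q w : I -> R) (u : 'rV[R]_d) (t : R)
    (m : nat) (c : nat -> R) (r : I -> nat) :
  (forall i, 1 - q i = expR (- w i)) -> 0 <= t ->
  (forall j k, (j < m)%N -> (k < m)%N -> (c j <= c k) = (j <= k)%N) ->
  (forall i, (r i < m)%N) -> (forall i, dot u (pt i) = c (r i)) ->
  exist_Pr q (fun A => width pt A u <= t) =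
  expR (- \sum_i w i) +
  \sum_(k < m) (expR (- \sum_(i | (r i < k)%N) w i) -
                expR (- \sum_(i | (r i < k.+1)%N) w i)) *
               expR (- \sum_(i | c k + t < dot u (pt i)) w i).
Proof.
move=> qw t0 c_le rm ac.
(* The exponents add because the two index sets are disjoint: rank at most [k] means height at most
   [c k], and t >= 0. *)
have E k l : (k < m)%N -> (l <= k.+1)%N ->
    expR (- \sum_(i | (r i < l)%N) w i) * expR (- \sum_(i | c k + t < dot u (pt i)) w i)
    = exist_Pr q (avoids (fun i => (r i < l)%N || (c k + t < dot u (pt i)))).
  move=> km lk; rewrite (exist_Pr_avoids qw) -expRD -opprD; congr (expR (- _)).
  rewrite [RHS](bigID (fun i => (r i < l)%N)) /=; congr (_ + _); apply: eq_bigl => i.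
    by case: (r i < l)%N; rewrite ?andbF.
  case: ltnP => //= rl; rewrite ?andbF ?andbT //; apply/negbTE; rewrite -leNgt ac.
  by apply: le_trans (_ : c k <= _); rewrite ?lerDl // c_le //; lia.
under [X in _ + X]eq_bigr => k _ do rewrite mulrBl !E ?ltn_ord //.
rewrite -(exist_Pr_avoids qw) !exist_PrE.
under [X in _ + X]eq_bigr do rewrite !exist_PrE -sumrB.
rewrite exchange_big -big_split /=; apply: eq_bigr => A _.
under eq_bigr do rewrite -mulrBr.
rewrite -mulr_sumr -mulrDr; congr (_ * _).
(* The empty set has width 0 <= t and is counted by the first term alone; in the sum its differences
   cancel. *)
have [->|A0] := eqVneq A finset.set0.
  rewrite width_set0 t0 (_ : avoids _ _); last by apply/forallP => i; rewrite inE.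
  rewrite big1 ?addr0 // => k _; rewrite /avoids.
  by apply/eqP; rewrite subr_eq0; apply/eqP; congr (_%:R); congr nat_of_bool;
    apply: eq_forallb => i; rewrite inE.
have [j [jA jmin ->]] := width_leE pt u t A0.
rewrite (_ : avoids predT A = false) ?add0r; last first.
  by apply/negbTE/forallPn; exists j; rewrite jA.
have av l P : avoids (fun i => (r i < l)%N || P i) A = (l <= r j)%N && avoids P A.
  apply/forallP/andP => [h|[lj /forallP h] i].
    split; first by have := h j; rewrite jA /= negb_or => /andP[]; rewrite -leqNgt.
    by apply/forallP => i; apply/implyP => iA; have := h i; rewrite iA negb_or => /andP[].
  apply/implyP => iA; have := h i; rewrite iA negb_or => /= ->; rewrite andbT.
  by rewrite -leqNgt (leq_trans lj) // -c_le // -!ac jmin.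
rewrite (bigD1 (Ordinal (rm j))) //= big1 => [|k kj]; rewrite !av.
  by rewrite leqnn ltnn subr0 addr0 -ac.
have : (k != r j :> nat) by [].
rewrite neq_ltn => /orP[] kr; first by rewrite kr (ltnW kr) subrr.
by rewrite leqNgt kr ltnNge (ltnW kr) subrr.
Qed.

(** Exchanging [h] for [h'] costs eta because the increments of [e] have total mass at most 1.
    Exchanging [e] for [e'] costs eta because the monotone [h'] has variation at most 1. *)
Lemma abel_stability (R : realType) (m : nat) (e e' h h' : nat -> R) (eta : R) :
  e 0%N = e' 0%N -> e m = e' m -> e 0%N - e m <= 1 ->
  (forall k, (k < m)%N -> e k.+1 <= e k) ->
  (forall k, (k <= m)%N -> `|e k - e' k| <= eta) ->
  (forall k, (k < m)%N -> `|h k - h' k| <= eta) ->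
  (forall k, (k.+1 < m)%N -> h' k <= h' k.+1) ->
  (forall k, (k < m)%N -> 0 <= h' k <= 1) ->
  `|\sum_(k < m) (e k - e k.+1) * h k - \sum_(k < m) (e' k - e' k.+1) * h' k|
    <= 2 * eta.
Proof.
move=> e0 em e1 edec ee hh hinc h01.
have eta0 : 0 <= eta by apply: le_trans (ee 0%N _).
pose D k := e k - e' k.
have -> : \sum_(k < m) (e k - e k.+1) * h k - \sum_(k < m) (e' k - e' k.+1) * h' k
  = \sum_(k < m) (e k - e k.+1) * (h k - h' k) + \sum_(k < m) (D k - D k.+1) * h' k.
  by rewrite -sumrB -big_split; apply: eq_bigr => k _; rewrite /D /=; ring.
rewrite mulr2n mulrDl mul1r; apply: le_trans (ler_normD _ _) (lerD _ _).
  apply: le_trans (ler_norm_sum _ _ _) _.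
  apply: (@le_trans _ _ (\sum_(k < m) (e k - e k.+1) * eta)).
    apply: ler_sum => k _; rewrite normrM ger0_norm ?subr_ge0 ?edec //.
    by rewrite ler_wpM2l ?subr_ge0 ?edec ?hh.
  have tele n : \sum_(k < n) (e k - e k.+1) = e 0%N - e n.
    by elim: n => [|n IH]; rewrite ?big_ord0 ?subrr // big_ord_recr /= IH; ring.
  by rewrite -mulr_suml -[leRHS]mul1r ler_wpM2r // tele.
case: m em {e1 edec hh} ee hinc h01 => [|m] em ee hinc h01.
  by rewrite big_ord0 normr0.
(* Partial summation keeps the boundary term [D j.+1 * h' j], which disappears at the end since
   [D m.+1 = 0]. *)
have abel j : (j <= m)%N ->
  `|\sum_(k < j.+1) (D k - D k.+1) * h' k + D j.+1 * h' j| <= eta * (h' j - h' 0%N).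
  elim: j => [_|j IH jm].
    rewrite big_ord1 /= subrr mulr0 /D e0 subrr sub0r mulNr addNr normr0 //.
  rewrite big_ord_recr /= (_ : _ + _ =
    (\sum_(k < j.+1) (D k - D k.+1) * h' k + D j.+1 * h' j) +
    D j.+1 * (h' j.+1 - h' j)); last by ring.
  apply: le_trans (ler_normD _ _) _.
  rewrite (_ : h' j.+1 - h' 0%N = (h' j - h' 0%N) + (h' j.+1 - h' j)); last by ring.
  rewrite [leRHS]mulrDr; apply: lerD; first exact/IH/ltnW.
  have hj := hinc j jm.
  by rewrite normrM [X in _ * X]ger0_norm ?subr_ge0 // ler_wpM2r ?subr_ge0 // ee // ltnW.
have Dm : D m.+1 = 0 by rewrite /D em subrr.
have := abel m (leqnn _); rewrite Dm mul0r addr0 => /le_trans; apply.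
have := h01 m (leqnn _); have := h01 0%N (ltn0Sn _); nra.
Qed.

Lemma exist_Pr_width_stable (R : realType) (d : nat) (I J : finType)
    (pt : I -> 'rV[R]_d) (pt' : J -> 'rV[R]_d)
    (q w : I -> R) (q' w' : J -> R) (u : 'rV[R]_d) (t eta : R) :
  (forall i, 1 - q i = expR (- w i)) -> (forall j, 1 - q' j = expR (- w' j)) ->
  (forall i, 0 <= w i) -> (forall j, 0 <= w' j) ->
  \sum_i w i = \sum_j w' j -> 0 <= t ->
  (forall s, `|\sum_(i | dot u (pt i) <= s) w i -
               \sum_(j | dot u (pt' j) <= s) w' j| <= eta) ->
  `|exist_Pr q (fun A => width pt A u <= t) -
    exist_Pr q' (fun A => width pt' A u <= t)| <= 2 * eta.
Proof.
move=> qw qw' w0 w0' ww t0 close.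
(* A common grid of heights for both families lets the two sums run over the same ranks. *)
pose vals := sort <=%O (undup (codom (fun i => dot u (pt i)) ++
                              codom (fun j => dot u (pt' j)))).
pose m := size vals; pose c := nth 0 vals.
have vals_sorted : sorted <%O vals by rewrite sort_lt_sorted undup_uniq.
have c_le j k : (j < m)%N -> (k < m)%N -> (c j <= c k) = (j <= k)%N.
  exact: lt_sorted_leq_nth.
have iv i : dot u (pt i) \in vals.
  by rewrite mem_sort mem_undup mem_cat codom_f.
have jv j : dot u (pt' j) \in vals.
  by rewrite mem_sort mem_undup mem_cat codom_f orbT.
pose r i := index (dot u (pt i)) vals; pose r' j := index (dot u (pt' j)) vals.
have rm i : (r i < m)%N by rewrite index_mem.
have rm' j : (r' j < m)%N by rewrite index_mem.
have cr i : dot u (pt i) = c (r i) by rewrite /c nth_index.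
have cr' j : dot u (pt' j) = c (r' j) by rewrite /c nth_index.
rewrite (exist_Pr_width qw t0 c_le rm cr) (exist_Pr_width qw' t0 c_le rm' cr').
rewrite ww opprD addrACA subrr add0r.
pose e k := expR (- \sum_(i | (r i < k)%N) w i).
pose e' k := expR (- \sum_(j | (r' j < k)%N) w' j).
pose h k := expR (- \sum_(i | c k + t < dot u (pt i)) w i).
pose h' k := expR (- \sum_(j | c k + t < dot u (pt' j)) w' j).
have rE k i : (k < m)%N -> (r i < k.+1)%N = (dot u (pt i) <= c k).
  by move=> km; rewrite ltnS -c_le ?cr.
have rE' k j : (k < m)%N -> (r' j < k.+1)%N = (dot u (pt' j) <= c k).
  by move=> km; rewrite ltnS -c_le ?cr'.
(* With equal total weights, closeness on closed lower halfplanes passes to their open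
   complements. *)
have compl (K : finType) (v a : K -> R) s :
    \sum_(i | s < a i) v i = \sum_i v i - \sum_(i | a i <= s) v i.
  rewrite [X in X - _](bigID (fun i => a i <= s)) /= addrAC subrr add0r.
  by apply: eq_bigl => i; rewrite ltNge.
apply: (@abel_stability _ m e e' h h').
- by rewrite /e /e' !big_pred0.
- rewrite /e /e' (eq_bigl xpredT) => [|i]; last by rewrite rm.
  by rewrite ww; congr (expR (- _)); apply: eq_bigl => j; rewrite rm'.
- by rewrite /e big_pred0 // oppr0 expR0 gerBl expR_ge0.
- move=> k km; rewrite ler_expR lerN2 [leRHS]big_mkcond [leLHS]big_mkcond.
  apply: ler_sum => i _; case: ltnP => [rk|]; last by case: ifP.
  by rewrite ltnW.
- move=> [_|k km].
    by rewrite /e /e' !big_pred0 // subrr normr0 (le_trans _ (close 0)).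
  apply: le_trans (expRN_lip _ _) _; rewrite ?sumr_ge0 //.
  rewrite (eq_bigl _ _ (fun i => rE k i km)) (eq_bigl _ _ (fun i => rE' k i km)).
  exact: close.
- move=> k km; apply: le_trans (expRN_lip _ _) _; rewrite ?sumr_ge0 //.
  rewrite !compl ww opprB [X in `|X|]addrC addrA subrK distrC.
  exact: close.
- move=> k km; rewrite ler_expR lerN2 [leRHS]big_mkcond [leLHS]big_mkcond.
  apply: ler_sum => j _; case: ifP => // h1; case: ifP => // /negbT; rewrite -leNgt => h2.
  have : c k <= c k.+1 by rewrite c_le // ltnW.
  by move: h1; lra.
- move=> k km; rewrite expR_ge0 /= -[leRHS]expR0 ler_expR oppr_le0 sumr_ge0 //.
Qed.

(** The empty realization alone has probability exp(- sum of [w]), and its width is 0. *)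
Lemma exist_Pr_width_ge (R : realType) (d : nat) (I : finType)
    (pt : I -> 'rV[R]_d) (q w : I -> R) (u : 'rV[R]_d) (t : R) :
  (forall i, 1 - q i = expR (- w i)) -> (forall i, 0 <= w i) -> 0 <= t ->
  1 - \sum_i w i <= exist_Pr q (fun A => width pt A u <= t).
Proof.
move=> qw w0 t0; apply: le_trans (expR_ge1Dx _) _.
rewrite -(exist_Pr_avoids qw) (exist_Pr_mono qw w0) // => A /forallP h.
suff -> : A = finset.set0 by rewrite width_set0.
by apply/setP => i; rewrite inE; apply/negbTE; have := h i; rewrite implybF.
Qed.

(** * Choice of the parameters *)

Lemma expRN_log_inv (R : realType) (delta : R) : 0 < delta ->
  expR (- log_inv delta) = Num.min delta (1 / 2).
Proof.
move=> d0; have m0 : 0 < Num.min delta (1 / 2) by rewrite lt_min d0 /=; lra.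
by rewrite /log_inv div1r lnV ?posrE // opprK lnK.
Qed.

Lemma log_inv_ge (R : realType) (delta : R) : 0 < delta -> 1 / 2 <= log_inv delta.
Proof.
move=> d0; rewrite leNgt; apply/negP => L2.
have : expR (- (1 / 2)) < expR (- log_inv delta) by rewrite ltr_expR ltrN2.
rewrite expRN_log_inv // lt_min => /andP[_].
by have := expR_ge1Dx (- (1 / 2) : R); lra.
Qed.

Lemma sample_count_bounds (R : realType) (c2 tau1 delta : R) :
  0 <= c2 -> 0 < delta ->
  c2 * tau1 ^- 2 * log_inv delta <= (sample_count c2 tau1 delta)%:R <
  c2 * tau1 ^- 2 * log_inv delta + 1.
Proof.
move=> c0 d0; set r := _ * log_inv delta.
have r0 : 0 <= r.
  rewrite /r !mulr_ge0 // ?invr_ge0 ?sqr_ge0 //.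
  by apply: le_trans (log_inv_ge d0).
rewrite /sample_count -/r natr_absz ger0_norm; last by rewrite ceil_ge0; lra.
by rewrite ceil_ge /= -ltrBlDr -(intrB _ _ 1) ceilB1_lt.
Qed.

(** Here [X] is N, [y] is (lambda / tau)^2 and [L] is [log_inv delta], so X / (32 y) = N eps^2 / 8.
    Half of this exponent, [z], absorbs the cubic factor and the other half gives exp(- L). *)
Lemma failure_bound (R : realType) (X y L : R) :
  1 <= X -> 1 <= y -> 1 / 2 <= L -> 2 * 144 * 64 ^+ 2 * y ^+ 2 * L <= X ->
  2 * (2 * X + 1) ^+ 3 * expR (- (X / (32 * y))) <= expR (- L).
Proof.
move=> X1 y1 L1 XL; pose z := X / (64 * y).
have y64 : 0 < 64 * y by lra.
have zy : z * (64 * y) = X by rewrite /z divfK // gt_eqF.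
have z0 : 0 < z by rewrite divr_gt0 //; lra.
have Lz : L <= z.
  rewrite /z ler_pdivlMr //; apply: le_trans XL.
  have : 0 <= L * (y ^+ 2 - y) by rewrite mulr_ge0 //; [lra|nra].
  have : 0 <= L * y ^+ 2 by rewrite mulr_ge0 ?sqr_ge0 //; lra.
  by lra.
have z2 : 144 * X <= z ^+ 2.
  have h1 : 2 * 144 * 64 ^+ 2 * y ^+ 2 * (1 / 2) <= X.
    by apply: le_trans XL; rewrite ler_wpM2l // mulr_ge0 ?sqr_ge0 //; lra.
  have h2 : z ^+ 2 * (64 * y) ^+ 2 = X ^+ 2 by rewrite -exprMn zy.
  have h3 : 144 * X * (64 * y) ^+ 2 <= X ^+ 2 by rewrite exprMn; move: (y ^+ 2) h1 => y2 h1; nra.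
  by move: h3; rewrite -h2 ler_pM2r // exprn_gt0.
(* exp z = (exp (z / 6)) ^ 6 dominates (z / 6) ^ 6, a cubic in X *)
have ez : 2 * (2 * X + 1) ^+ 3 <= expR z.
  have -> : z = 6%:R * (z / 6) by field.
  rewrite expRM_natl.
  apply: (@le_trans _ _ ((z / 6) ^+ 6)); last first.
    have e6 := expR_ge1Dx (z / 6).
    by rewrite lerXn2r ?nnegrE ?expR_ge0 //; lra.
  rewrite (_ : (z / 6) ^+ 6 = (z ^+ 2 / 36) ^+ 3); last by field.
  apply: (@le_trans _ _ ((4 * X) ^+ 3)); last first.
    by rewrite lerXn2r ?nnegrE //; lra.
  apply: (@le_trans _ _ (2 * (3 * X) ^+ 3)).
    by rewrite ler_pM2l // lerXn2r ?nnegrE //; lra.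
  by rewrite !exprMn mulrA ler_pM2r ?exprn_gt0 //; lra.
have -> : X / (32 * y) = z + z by rewrite /z; field; rewrite gt_eqF //; lra.
rewrite opprD expRD mulrA; apply: (@le_trans _ _ (expR (- z))).
  by rewrite ler_piMl ?expR_ge0 // expRN ler_pdivrMr ?expR_gt0 // mul1r.
by rewrite ler_expR lerN2.
Qed.

Lemma rate_ge0 (R : realType) (n : nat) (p : 'I_n -> R) :
  (forall v, 0 < p v < 1) -> forall v, 0 <= rate p v.
Proof.
by move=> p01 v; rewrite /rate oppr_ge0 ln_le0 //; have := p01 v; lra.
Qed.

Lemma expRN_rate (R : realType) (n : nat) (p : 'I_n -> R) :
  (forall v, 0 < p v < 1) -> forall v, 1 - p v = expR (- rate p v).
Proof.
by move=> p01 v; rewrite /rate opprK lnK // posrE; have := p01 v; lra.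
Qed.

(** * Approximation of the width distribution by the sampled set *)

Theorem mainTheorem14 (R : realType) :
  exists c1 c2 C : R, [/\ 0 < c1, 0 < c2, 0 < C &
    forall (n : nat) (pt : 'I_n -> 'rV[R]_2) (p : 'I_n -> R) (tau delta : R),
      injective pt ->
      (forall v, 0 < p v < 1) ->
      0 < tau <= 1 / 2 ->
      0 < delta < 1 ->
      let lambda := total_rate p in
      let tau1 := c1 * (tau / lambda) ^+ 2 in
      let N := sample_count c2 tau1 delta in
      N%:R <= C * (lambda ^+ 4 / tau ^+ 4 * log_inv delta) + 1 /\
      1 - delta <=
        sampling_Pr (rate_measure p) (fun x : {ffun 'I_N -> 'I_n} =>
          forall (t : R) (u : 'rV[R]_2), 0 <= t -> dot u u = 1 ->
            let prP := exist_Pr p (fun A => width pt A u <= t) in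
            let prS :=
              exist_Pr (fun _ : 'I_N => 1 - expR (- (lambda / N%:R)))
                       (fun A => width (fun i => pt (x i)) A u <= t) in
            prP - tau <= prS <= prP + tau)].
Proof.
(* The factor 2 offsets [1 / 2 <= log_inv delta]; 144 * 64^2 gives z^2 >= 144 N in
   [failure_bound]. *)
pose K : R := 2 * 144 * 64 ^+ 2; have K_gt0 : 0 < K by rewrite /K; lra.
exists 1, K, K; split=> // n pt p tau delta _ p01 tau01 delta01 lambda tau1 N.
have [tau0 tau2] := andP tau01; have [delta0 delta1] := andP delta01.
have /andP[N_ge N_lt] : K * (lambda / tau) ^+ 4 * log_inv delta <= N%:R <
    K * (lambda / tau) ^+ 4 * log_inv delta + 1.
  have := @sample_count_bounds R K tau1 delta (ltW K_gt0) delta0.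
  suff -> : tau1 ^- 2 = (lambda / tau) ^+ 4 by [].
  by rewrite /tau1 mul1r -exprM -exprVn invf_div.
clearbody N.
have L_ge := log_inv_ge delta0.
have rate0 := rate_ge0 p01; have prate := expRN_rate p01.
have lambda0 : 0 <= lambda by apply: sumr_ge0.
have lamN0 : 0 <= lambda / N%:R by rewrite divr_ge0.
have Srate : 1 - (1 - expR (- (lambda / N%:R))) = expR (- (lambda / N%:R)).
  by rewrite subKr.
split; first by rewrite -expr_div_n mulrA ltW.
have [lam_small|lam_big] := leP lambda tau.
  apply: (@le_trans _ _ 1); first by lra.
  rewrite le_eqVlt; apply/orP; left; apply/eqP.
  rewrite /sampling_Pr (eq_bigl xpredT) => [|x]; last first.
    apply/asboolP => t u t0 _ /=.
    have := exist_Pr_width_ge pt u prate rate0 t0.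
    have := exist_Pr_le1 prate rate0 (fun A => width pt A u <= t).
    have := exist_Pr_width_ge (fun i => pt (x i)) u (fun=> Srate) (fun=> lamN0) t0.
    have := exist_Pr_le1 (fun=> Srate) (fun=> lamN0) (fun A => width (fun i => pt (x i)) A u <= t).
    have : \sum_(i < N) lambda / N%:R <= lambda.
      rewrite sumr_const card_ord -[leLHS]mulr_natr; have [->|N0] := eqVneq N 0%N.
        by rewrite mulr0.
      by rewrite divfK // pnatr_eq0.
    rewrite -/(total_rate p) -/lambda.
    by move=> h1 h2 h3 h4 h5; apply/andP; split; lra.
  rewrite -(bigA_distr_bigA (fun _ v => rate_measure p v)) prodr_const card_ord.
  rewrite /rate_measure -mulr_suml -/(total_rate p) -/lambda.
  (* If lambda = 0, division by zero makes [rate_measure] vanish, but then N = 0 and the empty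
     product is 1. *)
  have [lam0|lam0] := eqVneq lambda 0; last by rewrite divff // expr1n.
  suff -> : N = 0%N by [].
  move: N_lt; rewrite lam0 mul0r expr0n mulr0 mul0r add0r.
  by rewrite (ltr_nat _ _ 1) ltnS leqn0 => /eqP.
have lam_gt0 : 0 < lambda by apply: lt_trans lam_big.
have x1 : 1 <= (lambda / tau) ^+ 2.
  by apply: exprn_ege1; rewrite ler_pdivlMr // mul1r ltW.
have N1 : (1 <= N%:R :> R).
  rewrite ler1n -(ltr0n R); apply: lt_le_trans N_ge.
  apply: mulr_gt0; last by lra.
  by apply: mulr_gt0 => //; rewrite exprn_gt0 // divr_gt0.
have mu0 v : 0 <= rate_measure p v by rewrite divr_ge0.
have mu1 : \sum_v rate_measure p v = 1.
  by rewrite /rate_measure -mulr_suml divff // gt_eqF.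
(* Scaled by lambda, accuracy [eps] becomes tau / 2 per halfplane, and stability doubles it to tau.
   The bound eps <= 1/2 comes from tau < lambda. *)
pose eps := tau / (2 * lambda).
have eps01 : 0 < eps <= 1 / 2.
  rewrite divr_gt0 ?mulr_gt0 //= ler_pdivrMr ?mulr_gt0 //; lra.
have trG (X : {set 'I_n}) : (#|X| <= N.*2)%N ->
    (#|traces (halfspaces pt) X| <= N.*2.+1 ^ 3)%N.
  move=> XN; apply: leq_trans (card_traces_le _ _) _.
    by move=> Y; apply: card_shattered_halfspaces.
  by rewrite leq_exp2r.
have := sampling_deviation_le mu0 mu1 eps01 trG.
set bad := \sum_(x | _) _ => bad_le.
have {bad_le} bad_delta : bad <= delta.
  apply: le_trans bad_le _.
  have := @failure_bound R N%:R ((lambda / tau) ^+ 2) (log_inv delta) N1 x1 L_ge.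
  rewrite -exprM => /(_ N_ge).
  rewrite expRN_log_inv // le_min => /andP[+ _]; apply: le_trans.
  have NE : N.*2.+1%:R = 2 * N%:R + 1 :> R by rewrite -muln2 -natr1 natrM mulrC.
  rewrite natrX NE le_eqVlt; apply/orP; left; apply/eqP.
  congr (_ * expR (- _)); rewrite /eps; field.
  by rewrite !gt_eqF.
apply: (@le_trans _ _ (1 - bad)); first by lra.
(* The total mass 1 splits into deviating samples, of mass [bad], and the others, which all satisfy
   the event. *)
rewrite lerBlDr -[leLHS](samples_prob_sum N mu1).
rewrite [leLHS](bigID (deviates (rate_measure p) (halfspaces pt) eps)) /=.
rewrite addrC lerD2r /sampling_Pr [leLHS]big_mkcond [leRHS]big_mkcond /=.
apply: ler_sum => x _; case: ifPn => [ndev|_]; last first.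
  by case: ifP => // _; apply: samples_prob_ge0.
rewrite asboolT // => t u t0 _ /=.
set prP := exist_Pr p _; set prS := exist_Pr _ _.
suff : `|prP - prS| <= 2 * (tau / 2).
  by rewrite ler_norml => /andP[h1 h2]; apply/andP; split; lra.
have N0 : (N%:R : R) != 0 by rewrite gt_eqF //; lra.
apply: (exist_Pr_width_stable prate (fun=> Srate) rate0 (fun=> lamN0)) => //.
  by rewrite sumr_const card_ord -[RHS]mulr_natr divfK.
(* Both weights are lambda times a measure of [H], once the rate measure and once the empirical
   one. *)
move=> s; pose H := [set v | dot u (pt v) <= s]%SET.
have /existsPn/(_ H) := ndev; rewrite mem_halfspaces /= -leNgt => devH.
have -> : \sum_(i | dot u (pt i) <= s) rate p i = lambda * \sum_(v in H) rate_measure p v.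
  rewrite /rate_measure -mulr_suml mulrCA divff ?gt_eqF // mulr1.
  by apply: eq_bigl => v; rewrite inE.
have -> : \sum_(j | dot u (pt (x j)) <= s) lambda / N%:R = lambda / N%:R * (hits x H)%:R.
  rewrite sumr_const mulr_natr /hits; congr (_ *+ _).
  by apply: eq_card => j; rewrite !inE.
rewrite distrC (_ : _ - _ = lambda / N%:R *
   ((hits x H)%:R - N%:R * \sum_(v in H) rate_measure p v)); last by field.
rewrite normrM ger0_norm //; apply: le_trans (ler_wpM2l lamN0 devH) _.
rewrite /eps le_eqVlt; apply/orP; left; apply/eqP; field.
by rewrite N0 gt_eqF.
Qed.
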